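(* Let $\Lambda^U(z)$ be the monic block characteristic polynomial of $A_j^{U,Z}$ with respect to $E_1R_B$, and suppose that $\Lambda^U(z)$ has simple and finite eigenvalues $\theta_1,\dots,\theta_{js}$. Then $$f(A)B-F_j=\sum_{i=1}^{js}\left[\varphi(A)f(A)-\varphi(\theta_i)f(\theta_i)I\right](A-\theta_iI)^{-1}\varphi(A)^{-1}\left(\Lambda^U(A)\circ B\right)v_iw_i^*$$ $$=\sum_{i=1}^{js}\left[\varphi(A)f(A)-\varphi(\theta_i)f(\theta_i)I\right](A-\theta_iI)^{-1}\,\Pi_{U,Z}\,U_{j+1}\,\Gamma_{j+1}^U\,R_B\,v_iw_i^*,$$ where $v_i,w_i\in\mathbb C^s$ are right and left eigenvectors of $\Lambda^U(z)$ associated with $\theta_i$ (i.e. $\Lambda^U(\theta_i)v_i=0$, $w_i^*\Lambda^U(\theta_i)=0$), normalized such that $w_i^*(\Lambda^U)'(\theta_i)v_i=1$.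
   Context: Let $A\in\mathbb C^{n\times n}$, $B\in\mathbb C^{n\times s}$ with $s>1$, $j\ge 1$, and shifts $\Sigma=\{\sigma_1,\dots,\sigma_{j-1}\}\subset\mathbb C\cup\{\infty\}$, the finite ones not eigenvalues of $A$. Put $\varphi(z)=\prod_{\sigma_i\neq\infty}(z-\sigma_i)$ and $E_1=e_1\otimes I_s\in\mathbb C^{js\times s}$, with $e_1$ the first canonical basis vector. For an $s\times s$ matrix polynomial $P(\lambda)=\sum_i\lambda^iP_i$, a square matrix $N$ and a block vector $W$ with $s$ columns, $P(N)\circ W:=\sum_iN^iWP_i$. Block rational Krylov spaces: $\mathcal{RK}^\square_j(A,B,\Sigma)=\{\varphi(A)^{-1}(P(A)\circ B):\deg P<j\}$ and $\mathcal{RK}^\square_{j+1}(A,B,\Sigma)=\{\varphi(A)^{-1}(P(A)\circ B):\deg P\le j\}$, where $P$ ranges over $s\times s$ matrix polynomials (in the second space the last pole is at infinity). Standing assumptions. The block rational Arnoldi procedure for building a block orthogonal basis of $\mathcal{RK}^\square_{j+1}(A,B,\Sigma)$ has been run without breakdown or deflation (every generated block has full rank $s$), with the last pole at infinity. It gives a matrix with orthonormal columns $\mathbf U_{j+1}=[U_1,\dots,U_{j+1}]$, $U_i\in\mathbb C^{n\times s}$, such that $\mathcal{RK}^\square_m(A,B,\Sigma)=\{\sum_{i\le m}U_iC_i: C_i\in\mathbb C^{s\times s}\}$ for $m=j,j+1$, with $B=U_1R_B$, $R_B\in\mathbb C^{s\times s}$, and block upper Hessenberg $(j+1)s\times js$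 matrices $\underline H_{U,j},\underline K_{U,j}$ (with $s\times s$ blocks) such that $A\mathbf U_{j+1}\underline K_{U,j}=\mathbf U_{j+1}\underline H_{U,j}$, the last block row of $\underline K_{U,j}$ being zero. $\Gamma_{j+1}^U$ is the block of $\underline H_{U,j}$ in block position $(j+1,j)$. Let $\mathbf U_j=[U_1,\dots,U_j]$, and let $\mathbf Z_j\in\mathbb C^{n\times js}$ have orthonormal columns with $\mathbf Z_j^*\mathbf U_j$ invertible. Put $A_j^{U,Z}=(\mathbf Z_j^*\mathbf U_j)^{-1}\mathbf Z_j^*A\mathbf U_j$ and $\Pi_{U,Z}=I-\mathbf U_j(\mathbf Z_j^*\mathbf U_j)^{-1}\mathbf Z_j^*$. The shifts $\sigma_i$ are not eigenvalues of $A_j^{U,Z}$. A block characteristic polynomial of $N\in\mathbb C^{js\times js}$ with respect to $W\in\mathbb C^{js\times s}$ is an $s\times s$ matrix polynomial $P$ of degree $j$ with $P(N)\circ W=0$; it is monic if its leading coefficient is $I_s$. In the present setting the monic block characteristic polynomial of $A_j^{U,Z}$ with respect to $E_1R_B$ is unique. Eigenvalues of a matrix polynomial $\Lambda$ are the roots of $\det\Lambda(z)$. The function $f$ is analytic around the eigenvalues of $A$, and the Petrov-Galerkin approximation of $f(A)B$ is $F_j=\mathbf U_jf(A_j^{U,Z})E_1R_B$, with $f(A_j^{U,Z})$ assumed to be defined.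
   Formalization: The second equality is proved assuming the last block column of (H,K) is scaled so that X R_B = φ(A)^{-1}(P(A)∘B) with P monic of degree j-1, X the last block of U_{j+1}K; without it (2H,2K) refutes it. Also θ_i are assumed not to be eigenvalues of A. *)

(* Defs.v *)
From mathcomp Require Import all_boot all_order all_algebra.
From mathcomp Require Import complex.
From mathcomp Require Import all_classical all_reals all_analysis.

Set Implicit Arguments.
Unset Strict Implicit.
Unset Printing Implicit Defensive.

Import Order.TTheory GRing.Theory Num.Theory.
Import numFieldNormedType.Exports.

Local Open Scope sesquilinear_scope.
Local Open Scope classical_set_scope.
Local Open Scope ring_scope.

(* [horner_mx] and [mxminpoly] only apply to matrices whose dimension is       *)
(* syntactically a successor; these two versions have no such restriction.    *)
Definition horner_mxn (K : fieldType) (n : nat) (N : 'M[K]_n) (p : {poly K}) :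
    'M[K]_n :=
  \sum_(i < size p) p`_i *: N ^+ i.

Definition minpoly_mxn (K : fieldType) (n : nat) : 'M[K]_n -> {poly K} :=
  if n is n'.+1 then fun N => @mxminpoly K n' N else fun=> 1.

Section MatrixFunction.
Variable R : realType.
Local Notation C := (R[i]).

Definition analytic_at (f : C -> C) (a : C) : Prop :=
  exists c : nat -> C, \forall z \near (a : C^o),
    (fun m : nat => \sum_(0 <= i < m) c i * (z - a) ^+ i : C^o) @ \oo
      --> (f z : C^o).

Definition cderive (k : nat) (f : C -> C) : C -> C :=
  derive1n k (f : C -> C^o).

(* The derivatives f^(k)(a), for a an eigenvalue of N and k smaller than the   *)
(* multiplicity of a in the minimal polynomial of N, all exist.               *)
Definition mxfun_defined (f : C -> C) (n : nat) (N : 'M[C]_n) : Prop :=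
  forall (a : C) (k : nat), (k.+1 < mup a (minpoly_mxn N))%N ->
    derivable (cderive k f : C^o -> C^o) a 1.

Definition hermite_interpolant (f : C -> C) (n : nat) (N : 'M[C]_n)
    (p : {poly C}) : Prop :=
  forall (a : C) (k : nat), (k < mup a (minpoly_mxn N))%N ->
    p^`(k).[a] = cderive k f a.

(* f(N) = p(N) for any polynomial p that agrees with f on the spectrum of N;   *)
(* such p exist, and p(N) does not depend on the choice of p.                 *)
Definition mxfun (f : C -> C) (n : nat) (N : 'M[C]_n) : 'M[C]_n :=
  horner_mxn N (xget 0 [set p | hermite_interpolant f N p]).

End MatrixFunction.

(* An s x s matrix polynomial is an s x s matrix P of scalar polynomials; its  *)
(* i-th matrix coefficient is P_i = mpcoef P i.                               *)
Section MatrixPolynomial.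
Variables (K : fieldType) (s : nat).
Implicit Types (P : 'M[{poly K}]_s) (z : K).

(* 1 + deg P, and 0 for P = 0, following the convention of [size].            *)
Definition mpsize P : nat := \max_(a < s) \max_(b < s) size (P a b).

Definition mpcoef P (i : nat) : 'M[K]_s := map_mx (coefp i) P.

Definition mphorner P z : 'M[K]_s := map_mx (horner_eval z) P.

Definition mpderiv P : 'M[{poly K}]_s := map_mx (@deriv K) P.

Definition mpmonic (d : nat) P : Prop :=
  mpsize P = d.+1 /\ mpcoef P d = 1%:M.

(* P(N) o W = \sum_i N^i W P_i                                                *)
Definition mpcirc P (n : nat) (N : 'M[K]_n) (W : 'M[K]_(n, s)) : 'M[K]_(n, s) :=
  \sum_(i < mpsize P) N ^+ i *m W *m mpcoef P i.

Definition monic_block_charpoly (d n : nat) (N : 'M[K]_n) (W : 'M[K]_(n, s)) P :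
    Prop :=
  mpmonic d P /\ mpcirc P N W = 0.

End MatrixPolynomial.

(* The number of blocks is j = k.+1, with k = j - 1 shifts; the shift at       *)
(* infinity is None.  Matrices made of j x j blocks of size s x s have         *)
(* dimension \sum_(i < j) s = j s, as in \mxrow, \mxcol and [submxblock].      *)
Section BlockRationalKrylov.
Variable C : numClosedFieldType.
Variables (n s k : nat).
Implicit Types (A : 'M[C]_n) (B : 'M[C]_(n, s)) (sigma : 'I_k -> option C)
  (U : 'I_k.+2 -> 'M[C]_(n, s)) (RB : 'M[C]_s)
  (H Kx : 'M[C]_(\sum_(i < k.+2) s, \sum_(i < k.+1) s))
  (Z : 'M[C]_(n, \sum_(i < k.+1) s)).

Definition shift_poly sigma : {poly C} :=
  \prod_(i < k) (if sigma i is Some x then 'X - x%:P else 1).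

(* phi(A)^-1 (P(A) o B) for deg P < m                                         *)
Definition block_krylov A B sigma (m : nat) : set 'M[C]_(n, s) :=
  [set invmx (horner_mxn A (shift_poly sigma)) *m mpcirc P A B
    | P in [set P : 'M[{poly C}]_s | (mpsize P <= m)%N]].

(* \sum_(i <= m) U_i C_i, the blocks of U being numbered from 0               *)
Definition block_span U (m : nat) : set 'M[C]_(n, s) :=
  [set \sum_(i < k.+2 | (i < m)%N) U i *m D i
    | D in [set: 'I_k.+2 -> 'M[C]_s]].

Definition basis_all U : 'M[C]_(n, \sum_(i < k.+2) s) := \mxrow_(i < k.+2) U i.

Definition basis_init U : 'M[C]_(n, \sum_(i < k.+1) s) :=
  \mxrow_(i < k.+1) U (widen_ord (leqnSn k.+1) i).

Definition block_e1 : 'M[C]_(\sum_(i < k.+1) s, s) :=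
  \mxcol_(i < k.+1) ((i == ord0)%:R%:M : 'M[C]_s).

Definition block_hessenberg H : Prop :=
  forall (a : 'I_k.+2) (b : 'I_k.+1), (b.+1 < a)%N -> submxblock H a b = 0.

(* The block of H in position (j+1, j), called Gamma_(j+1)                     *)
Definition last_subdiag H : 'M[C]_s := submxblock H ord_max ord_max.

Record block_rational_arnoldi A B sigma U RB H Kx : Prop :=
  BlockRationalArnoldi {
    bra_orthonormal : (basis_all U)^t* *m basis_all U = 1%:M ;
    bra_span_j : block_krylov A B sigma k.+1 = block_span U k.+1 ;
    bra_span_jS : block_krylov A B sigma k.+2 = block_span U k.+2 ;
    bra_start : B = U ord0 *m RB ;
    bra_hessH : block_hessenberg H ;
    bra_hessK : block_hessenberg Kx ;
    bra_rel : A *m basis_all U *m Kx = basis_all U *m H ;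
    bra_last_pole : forall b : 'I_k.+1, submxblock Kx ord_max b = 0 ;
    bra_full_rank_start : RB \in unitmx ;
    bra_full_rank_last : last_subdiag H \in unitmx }.

(* The relation A U_(j+1) K = U_(j+1) H determines the last block columns of   *)
(* (H, K) only up to a common right factor, which also rescales Gamma_(j+1).   *)
(* The last Arnoldi step, whose pole is infinity, orthogonalizes A X for the   *)
(* block X = U_(j+1) K E_j; the scaling is fixed by requiring that             *)
(* X R_B = phi(A)^-1 (P(A) o B) with P monic of degree j - 1.  This is always  *)
(* reachable, and when all shifts are finite X = U_1 has it with P = phi I.    *)
Definition pencil_normalized A B sigma U RB Kx : Prop :=
  exists2 P : 'M[{poly C}]_s, mpmonic k P &
    basis_all U *m submxrow Kx ord_max *m RB =
    invmx (horner_mxn A (shift_poly sigma)) *m mpcirc P A B.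

Definition pg_matrix A U Z : 'M[C]_(\sum_(i < k.+1) s) :=
  invmx (Z^t* *m basis_init U) *m Z^t* *m A *m basis_init U.

Definition pg_coprojector U Z : 'M[C]_n :=
  1%:M - basis_init U *m invmx (Z^t* *m basis_init U) *m Z^t*.

End BlockRationalKrylov.

Definition pg_approx (R : realType) (n s k : nat) (f : R[i] -> R[i])
    (A : 'M[R[i]]_n) (U : 'I_k.+2 -> 'M[R[i]]_(n, s)) (RB : 'M[R[i]]_s)
    (Z : 'M[R[i]]_(n, \sum_(i < k.+1) s)) : 'M[R[i]]_(n, s) :=
  basis_init U *m mxfun f (pg_matrix A U Z) *m block_e1 _ s k *m RB.

(* Main.v *)
Require Import Defs.
From mathcomp Require Import all_boot all_order all_algebra.
From mathcomp Require Import complex.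
From mathcomp Require Import all_classical all_reals all_analysis.

Set Implicit Arguments.
Unset Strict Implicit.
Unset Printing Implicit Defensive.

Import Order.TTheory GRing.Theory Num.Theory.
Import numFieldNormedType.Exports.

Local Open Scope sesquilinear_scope.
Local Open Scope classical_set_scope.
Local Open Scope ring_scope.

(** A single polynomial [p] can interpolate [f], with the right multiplicities,
    at the roots of the minimal polynomial of [A] and at the simple roots
    [theta_i] of [\det Lambda] ([hermite_exists]).  The latter control the
    projected matrix [N]: from [Lambda(N) o W = 0] it follows that
    [\det Lambda(N) W = 0] ([mpcirc_eq0_det]), and then [\det Lambda(N) = 0]
    since [W] generates the projected space ([galerkin_annihilator]).  Hence
    [f(A) = p(A)], [f(N) = p(N)] and [f(theta_i) = p(theta_i)], and the claim
    becomes a statement on the polynomial [p].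

    Put [q = phi p].  As the eigenvalues are simple, [Lambda(z)^-1] has the
    partial fraction expansion [\sum_i (z - theta_i)^-1 v_i w_i^*]
    ([partial_fractions]).  Multiplying it by [q(z)] gives a division with
    remainder [q I = Lambda Q + S], in which
    [Q(z) = \sum_i (q(z) - q(theta_i)) / (z - theta_i) v_i w_i^*] and [S] has
    degree less than [j].  The operation [P(A) o B] turns products into
    successive actions ([mpcircM]), so that
    [q(A) B = Q(A) o (Lambda(A) o B) + S(A) o B], while on the projected side
    [q(N) W = S(N) o W].  The projection is exact on
    [phi(A)^-1 (S(A) o B)] because [deg S < j] ([galerkin_exact]); subtracting
    leaves [phi(A)^-1 (Q(A) o (Lambda(A) o B))], which is the first formula
    ([projection_error]).

    For the second formula, let [Pi] be the oblique projector that annihilates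
    the first [j] basis blocks.  It fixes the residual
    [phi(A)^-1 (Lambda(A) o B)], again because [Lambda(N) o W = 0].  On the other
    hand the residual differs from [A X R_B], where [X] is the block that the
    last Arnoldi step multiplies by [A], only by something [Pi] annihilates, and
    the component of [A X] outside the first [j] blocks is
    [U_(j+1) Gamma_(j+1)] ([galerkin_residual]). *)

(** * Hermite interpolation *)

(** The Taylor coefficients at [a] are the coefficients after the shift of [a] to
    the origin, where divisibility by a power of [X] is easy to read off. *)
Lemma derivn_horner_shift (K : fieldType) (p : {poly K}) (a : K) (i : nat) :
  p^`(i).[a] = (p \Po ('X + a%:P))`_i *+ i`!.
Proof.
rewrite nderivn_def hornerMn; congr (_ *+ _).
rewrite /comp_poly addrC (nderiv_taylor _ (commr_polyX _)) size_map_polyC.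
under eq_bigr do rewrite nderivn_map horner_map /=.
under eq_bigr do rewrite mul_polyC.
rewrite -(poly_def (size p) (fun j => p^`N(j).[a])) coef_poly.
by case: ltnP => // /nderivn_poly0 ->; rewrite horner0.
Qed.

Section HermiteInterpolation.
Variable C : numClosedFieldType.
Implicit Types (m p t : {poly C}) (a : C).

Lemma mup_poly0 a : mup a (0 : {poly C}) = 0%N.
Proof.
by apply/eqP; rewrite -leqn0 -ltnS -[X in (_ < X.+1)%N](size_poly0 C) ltn_ord.
Qed.

Lemma mup_dvdp_leq p m a : m != 0 -> p %| m -> (mup a p <= mup a m)%N.
Proof.
move=> m0 pm; have p0 : p != 0 by apply: contraTneq pm => ->; rewrite dvd0p.
by rewrite mup_geq // (dvdp_trans _ pm) // -mup_geq.
Qed.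

Lemma mup_factor m a : m != 0 ->
  exists2 r, ~~ root r a & m = r * ('X - a%:P) ^+ mup a m.
Proof.
move=> m0; have := mup_geq a (mup a m) m0; rewrite leqnn => /esym/dvdpP[r mE].
exists r => //; apply/negP; rewrite root_factor_theorem => /dvdpP[u rE].
have := mup_geq a (mup a m).+1 m0; rewrite ltnn => /esym/negP; apply.
by apply/dvdpP; exists u; rewrite exprS mulrA -rE.
Qed.

Lemma derivn_mul_lt_mup m t a i : m != 0 -> (i < mup a m)%N ->
  (m * t)^`(i).[a] = 0.
Proof.
move=> m0 lt_i; have [r _ mE] := mup_factor a m0.
rewrite derivn_horner_shift mE mulrAC comp_polyM rmorphXn /= rmorphB /=.
by rewrite comp_polyX comp_polyC addrK coefMXn lt_i mul0rn.
Qed.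

Lemma derivn_mul_mup m a : m != 0 ->
  exists2 c, c != 0 & forall t, (m * t)^`(mup a m).[a] = c * t.[a].
Proof.
move=> m0; have [r ra mE] := mup_factor a m0.
exists (r.[a] *+ (mup a m)`!).
  by rewrite mulrn_eq0 negb_or -lt0n fact_gt0.
move=> t; rewrite derivn_horner_shift {1}mE mulrAC comp_polyM rmorphXn /=.
rewrite rmorphB /= comp_polyX comp_polyC addrK coefMXn ltnn subnn.
by rewrite -horner_coef0 horner_comp !hornerE mulrnAl.
Qed.

Lemma poly_root_ind (Q : {poly C} -> Prop) :
  (forall c, c != 0 -> Q c%:P) ->
  (forall m a, m != 0 -> Q m -> Q (m * ('X - a%:P))) ->
  forall m, m != 0 -> Q m.
Proof.
move=> QC QX m m0; have [rs ->] := closed_field_poly_normal m.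
have : lead_coef m != 0 by rewrite lead_coef_eq0.
move: (lead_coef m) => c c0; elim: rs => [|a s IHs].
  by rewrite big_nil alg_polyC; exact: QC.
rewrite big_cons mulrC scalerAl; apply: QX => //.
by rewrite scaler_eq0 negb_or c0 monic_neq0 // monic_prod_XsubC.
Qed.

Lemma mup_mulXsubC m a b : m != 0 ->
  mup b (m * ('X - a%:P)) = (mup b m + (a == b))%N.
Proof.
move=> m0; rewrite mupM ?polyXsubC_eq0 // -['X - a%:P]expr1 mup_XsubCX.
by case: eqP.
Qed.

(** Adding the root [a] to the node polynomial [m] adds a single condition, on
    the derivative of order [mup a m] at [a]; adding a multiple of [m] to the
    previous interpolant leaves the other conditions intact and solves it. *)
Lemma hermite_exists m (y : C -> nat -> C) : m != 0 ->
  exists p, forall a i, (i < mup a m)%N -> p^`(i).[a] = y a i.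
Proof.
move: m; apply: poly_root_ind => [c c0|m a m0 [p pE]].
  exists 0 => a i; rewrite mupNroot // rootE hornerC //.
have [c c0 cE] := derivn_mul_mup a m0.
exists (p + m * (c^-1 * (y a (mup a m) - p^`(mup a m).[a]))%:P) => b i.
rewrite mup_mulXsubC // derivnD hornerD.
have [lt_i _|le_i] := ltnP i (mup b m).
  by rewrite derivn_mul_lt_mup // addr0 pE.
have [ab|_] := eqVneq a b; last by rewrite addn0 ltnNge le_i.
subst b; rewrite addn1 ltnS => ge_i.
have -> : i = mup a m by apply/eqP; rewrite eqn_leq ge_i le_i.
by rewrite cE hornerC mulVKf // subrKC.
Qed.

Lemma hermite_unique m p : m != 0 ->
  (forall a i, (i < mup a m)%N -> p^`(i).[a] = 0) -> m %| p.
Proof.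
move=> m0; move: m m0 p; apply: poly_root_ind => [c c0 p _|m a m0 IHm p p0].
  by rewrite -alg_polyC dvdpZl // dvd1p.
have /dvdpP[t pE] : m %| p.
  by apply: IHm => b i lt_i; apply: p0; rewrite mup_mulXsubC // ltn_addr.
rewrite pE [t * m]mulrC dvdp_mul2l // dvdp_XsubCl.
have [c c0 cE] := derivn_mul_mup a m0.
have := p0 a (mup a m); rewrite mup_mulXsubC // eqxx addn1 ltnSn => /(_ isT).
by rewrite pE mulrC cE => /eqP; rewrite mulf_eq0 (negPf c0) rootE.
Qed.

End HermiteInterpolation.

(** * Polynomials and block polynomials of a matrix *)

Section MatrixHorner.
Variables (K : fieldType) (n : nat).
Implicit Types (N : 'M[K]_n) (p q : {poly K}).

Lemma horner_mxn_wide N p d : (size p <= d)%N ->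
  horner_mxn N p = \sum_(i < d) p`_i *: N ^+ i.
Proof.
move=> le_pd; rewrite /horner_mxn (big_ord_widen _ (fun i => p`_i *: N ^+ i) le_pd).
rewrite big_mkcond; apply: eq_bigr => i _; case: ltnP => // le_pi.
by rewrite nth_default // scale0r.
Qed.

Lemma horner_mxnD N p q : horner_mxn N (p + q) = horner_mxn N p + horner_mxn N q.
Proof.
pose d := maxn (size p) (size q).
rewrite !(@horner_mxn_wide N _ d) ?leq_maxl ?leq_maxr ?size_polyD //.
by rewrite -big_split; apply: eq_bigr => i _; rewrite coefD scalerDl.
Qed.

Lemma horner_mxnZ N c p : horner_mxn N (c *: p) = c *: horner_mxn N p.
Proof.
rewrite (@horner_mxn_wide _ _ (size p)) ?size_scale_leq // scaler_sumr.
by apply: eq_bigr => i _; rewrite coefZ scalerA.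
Qed.

Lemma horner_mxn0 N : horner_mxn N 0 = 0.
Proof. by rewrite /horner_mxn size_poly0 big_ord0. Qed.

Lemma horner_mxn_sum N (I : Type) (r : seq I) (F : I -> {poly K}) :
  horner_mxn N (\sum_(i <- r) F i) = \sum_(i <- r) horner_mxn N (F i).
Proof. exact: (big_morph _ (horner_mxnD N) (horner_mxn0 N)). Qed.

Lemma horner_mxnXn N i : horner_mxn N 'X^i = N ^+ i.
Proof.
rewrite /horner_mxn size_polyXn big_ord_recr big1 /= => [|j _].
  by rewrite coefXn eqxx scale1r add0r.
by rewrite coefXn ltn_eqF ?scale0r.
Qed.

Lemma horner_mxnX N : horner_mxn N 'X = N.
Proof. by rewrite -['X]expr1 horner_mxnXn expr1. Qed.

Lemma horner_mxnC N c : horner_mxn N c%:P = c%:M.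
Proof. by rewrite -alg_polyC horner_mxnZ -(expr0 'X) horner_mxnXn expr0 scalemx1. Qed.

Lemma horner_mxn1 N : horner_mxn N 1 = 1%:M.
Proof. by rewrite horner_mxnC. Qed.

Lemma horner_mxnM N p q : horner_mxn N (p * q) = horner_mxn N p *m horner_mxn N q.
Proof.
rewrite -{1}(coefK p) poly_def mulr_suml horner_mxn_sum mulmx_suml.
apply: eq_bigr => i _; rewrite -scalerAl horner_mxnZ -scalemxAl; congr (_ *: _).
rewrite -{1}(coefK q) poly_def mulr_sumr horner_mxn_sum mulmx_sumr.
apply: eq_bigr => j _; rewrite -scalerAr horner_mxnZ -scalemxAr; congr (_ *: _).
by rewrite -exprD horner_mxnXn exprD.
Qed.

Lemma horner_mxn_comm N p q :
  horner_mxn N p *m horner_mxn N q = horner_mxn N q *m horner_mxn N p.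
Proof. by rewrite -!horner_mxnM mulrC. Qed.

Lemma horner_mxn_unit N (I : Type) (r : seq I) (F : I -> {poly K}) :
  (forall i, horner_mxn N (F i) \in unitmx) ->
  horner_mxn N (\prod_(i <- r) F i) \in unitmx.
Proof.
move=> unitF; apply: (big_ind (fun p => horner_mxn N p \in unitmx)) => //.
  by rewrite horner_mxn1 unitmx1.
by move=> p q unitp unitq; rewrite horner_mxnM unitmx_mul unitp unitq.
Qed.

Lemma horner_mxn_XsubC N c : horner_mxn N ('X - c%:P) = N - c%:M.
Proof. by rewrite -polyCN horner_mxnD horner_mxnX horner_mxnC raddfN. Qed.

Lemma eigenvalueN_unitmx N c : ~~ eigenvalue N c -> N - c%:M \in unitmx.
Proof.
by rewrite /eigenvalue negbK /eigenspace kermx_eq0 row_free_unit.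
Qed.

End MatrixHorner.

Lemma minpoly_mxn_neq0 (K : fieldType) (n : nat) (N : 'M[K]_n) :
  minpoly_mxn N != 0.
Proof.
by case: n N => [|n] N; rewrite /= ?oner_eq0 // monic_neq0 // mxminpoly_monic.
Qed.

Lemma horner_mxnE (K : fieldType) (n : nat) (N : 'M[K]_n.+1) (p : {poly K}) :
  horner_mxn N p = horner_mx N p.
Proof.
rewrite -[in RHS](coefK p) poly_def rmorph_sum; apply: eq_bigr => i _.
rewrite -mul_polyC rmorphM /= horner_mx_C rmorphXn /= horner_mx_X.
by rewrite -mulmxE mul_scalar_mx.
Qed.

Lemma minpoly_mxn_dvd (K : fieldType) (n : nat) (N : 'M[K]_n) (p : {poly K}) :
  (minpoly_mxn N %| p) = (horner_mxn N p == 0).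
Proof.
case: n N => [|n] N /=; first by rewrite dvd1p flatmx0 eqxx.
by rewrite horner_mxnE; apply/mxminpoly_minP/eqP.
Qed.

Section BlockPolynomials.
Variables (K : fieldType) (s n : nat).
Implicit Types (P Q : 'M[{poly K}]_s) (N : 'M[K]_n) (W : 'M[K]_(n, s)).

Lemma size_mpsize P a b : (size (P a b) <= mpsize P)%N.
Proof.
apply: leq_trans (leq_bigmax_cond _ (erefl true)) => /=.
exact: (leq_bigmax_cond (F := fun b => size (P a b))).
Qed.

Lemma mpsize_leq P d : (forall a b, (size (P a b) <= d)%N) -> (mpsize P <= d)%N.
Proof. by move=> le_Pd; apply/bigmax_leqP => a _; apply/bigmax_leqP => b _. Qed.

Lemma mpcirc_wide P N W d : (mpsize P <= d)%N ->
  mpcirc P N W = \sum_(i < d) N ^+ i *m W *m mpcoef P i.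
Proof.
move=> le_Pd.
rewrite /mpcirc (big_ord_widen _ (fun i => N ^+ i *m W *m mpcoef P i) le_Pd).
rewrite big_mkcond; apply: eq_bigr => i _; case: ltnP => // le_Pi.
have -> : mpcoef P i = 0.
  apply/matrixP => a b; rewrite !mxE /coefp nth_default //.
  exact: leq_trans (size_mpsize P a b) _.
by rewrite mulmx0.
Qed.

(** The entries of [P] are scalar polynomials and commute at [N]; this form
    reduces identities on [mpcirc] to those on [horner_mxn]. *)
Lemma mpcirc_entries P N W :
  mpcirc P N W = \sum_a \sum_b horner_mxn N (P a b) *m W *m delta_mx a b.
Proof.
rewrite /mpcirc; pose d := mpsize P.
under eq_bigr => i _ do rewrite [mpcoef P i]matrix_sum_delta mulmx_sumr.
rewrite exchange_big /=; apply: eq_bigr => a _.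
under eq_bigr => i _ do rewrite mulmx_sumr.
rewrite exchange_big /=; apply: eq_bigr => b _.
rewrite (horner_mxn_wide _ (size_mpsize P a b)) !mulmx_suml.
by apply: eq_bigr => i _; rewrite !mxE -scalemxAr -!scalemxAl.
Qed.

Lemma mpcircD P Q N W : mpcirc (P + Q) N W = mpcirc P N W + mpcirc Q N W.
Proof.
rewrite !mpcirc_entries -big_split; apply: eq_bigr => a _.
rewrite -big_split; apply: eq_bigr => b _.
by rewrite mxE horner_mxnD !mulmxDl.
Qed.

Lemma mpcirc0 N W : mpcirc 0 N W = 0.
Proof.
rewrite mpcirc_entries big1 // => a _; rewrite big1 // => b _.
by rewrite mxE horner_mxn0 !mul0mx.
Qed.

Lemma mpcirc_sum N W (I : Type) (r : seq I) (F : I -> 'M[{poly K}]_s) :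
  mpcirc (\sum_(i <- r) F i) N W = \sum_(i <- r) mpcirc (F i) N W.
Proof.
apply: (big_morph (fun P => mpcirc P N W)) => [P Q|].
- exact: mpcircD.
- exact: mpcirc0.
Qed.

Lemma mpcircr0 P N : mpcirc P N 0 = 0.
Proof. by rewrite /mpcirc big1 // => i _; rewrite mulmx0 mul0mx. Qed.

Lemma mpcirc_scale p (M : 'M[K]_s) N W :
  mpcirc (p *: map_mx polyC M) N W = horner_mxn N p *m W *m M.
Proof.
rewrite mpcirc_entries [in RHS](matrix_sum_delta M) mulmx_sumr.
apply: eq_bigr => a _; rewrite mulmx_sumr; apply: eq_bigr => b _.
by rewrite !mxE mulrC mul_polyC horner_mxnZ -scalemxAr -!scalemxAl.
Qed.

Lemma mpcirc_scalar p N W : mpcirc p%:M N W = horner_mxn N p *m W.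
Proof. by rewrite -scalemx1 -(map_mx1 polyC) mpcirc_scale mulmx1. Qed.

(** [N] acts on the left and the coefficients on the right, so the factors of
    a product act one after the other. *)
Lemma mpcircM P Q N W : mpcirc (P *m Q) N W = mpcirc Q N (mpcirc P N W).
Proof.
rewrite [RHS]mpcirc_entries exchange_big [LHS]mpcirc_entries /= exchange_big /=.
apply: eq_bigr => b _.
under eq_bigr => a _ do rewrite mxE horner_mxn_sum 2!mulmx_suml.
rewrite exchange_big /=; apply: eq_bigr => c _.
rewrite mpcirc_entries mulmx_sumr [RHS]mulmx_suml; apply: eq_bigr => a _.
rewrite mulmx_sumr [RHS]mulmx_suml [RHS](bigD1 c) //= big1 => [|d dc].
  by rewrite addr0 [P a c * _]mulrC horner_mxnM !mulmxA -[in RHS]mulmxA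
     mul_delta_mx.
by rewrite -!mulmxA mul_delta_mx_0 ?mulmx0.
Qed.

Lemma mpcirc_mulmx p P N W :
  mpcirc P N (horner_mxn N p *m W) = horner_mxn N p *m mpcirc P N W.
Proof.
rewrite -!mpcirc_scalar -!mpcircM; congr (mpcirc _ N W).
by rewrite mul_scalar_mx mul_mx_scalar.
Qed.

End BlockPolynomials.

(** [\det P] is the multiple [P *m \adj P] of [P]. *)
Lemma mpcirc_eq0_det (K : fieldType) (s n : nat) (P : 'M[{poly K}]_s)
    (N : 'M[K]_n) (W : 'M[K]_(n, s)) :
  mpcirc P N W = 0 -> horner_mxn N (\det P) *m W = 0.
Proof.
move=> P0; rewrite -mpcirc_scalar -mul_mx_adj mpcircM P0.
exact: mpcircr0.
Qed.

Lemma mpsize_sub_monic (K : fieldType) (s d : nat) (P Q : 'M[{poly K}]_s) :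
  (mpsize P <= d.+1)%N -> (mpsize Q <= d.+1)%N -> mpcoef P d = mpcoef Q d ->
  (mpsize (P - Q) <= d)%N.
Proof.
move=> szP szQ PQ; apply: mpsize_leq => a b; apply/leq_sizeP => i.
rewrite !mxE coefB leq_eqVlt => /predU1P[<-|lt_i].
  by have /matrixP/(_ a b) := PQ; rewrite !mxE /coefp => ->; rewrite subrr.
by rewrite !nth_default ?subrr // (leq_trans (size_mpsize _ a b)) //
   (leq_trans _ lt_i).
Qed.


(** * Matrix functions *)

(** Two interpolants agree modulo the minimal polynomial of [N], so the one that
    the definition of [mxfun] picks may be replaced by any other. *)
Lemma mxfun_interpolant (R : realType) (f : R[i] -> R[i]) (n : nat)
    (N : 'M[R[i]]_n) (p : {poly R[i]}) :
  hermite_interpolant f N p -> mxfun f N = horner_mxn N p.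
Proof.
move=> fp; rewrite /mxfun; set q := xget _ _.
have fq : [set q | hermite_interpolant f N q] q by apply: xgetPex; exists p.
apply/eqP; rewrite -subr_eq0 -scaleN1r -horner_mxnZ -horner_mxnD -minpoly_mxn_dvd.
apply: hermite_unique (minpoly_mxn_neq0 N) _ => a i lt_i.
by rewrite scaleN1r derivnB hornerD hornerN fp // fq // subrr.
Qed.

(** * Matrix polynomials with simple eigenvalues *)

Lemma map_horner_lift (K : comNzRingType) (m n : nat) (M : 'M[K]_(m, n)) (a : K) :
  map_mx (horner_eval a) (map_mx polyC M) = M.
Proof. by apply/matrixP => i j; rewrite !mxE /horner_eval hornerC. Qed.

Lemma mx_factor_root (K : fieldType) (m n : nat) (M : 'M[{poly K}]_(m, n)) (a : K) :
  map_mx (horner_eval a) M = 0 -> exists G, M = ('X - a%:P) *: G.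
Proof.
move=> M0; exists (map_mx (fun p => p %/ ('X - a%:P)) M).
apply/matrixP => i j; rewrite !mxE mulrC divpK // dvdp_XsubCl rootE.
by have /matrixP/(_ i j) := M0; rewrite !mxE => /eqP.
Qed.

Lemma scalemx_inj (K : idomainType) (m n : nat) (c : K) (M M' : 'M[K]_(m, n)) :
  c != 0 -> c *: M = c *: M' -> M = M'.
Proof.
move=> c0 /matrixP MM'; apply/matrixP => i j; apply: (mulfI c0).
by have := MM' i j; rewrite !mxE.
Qed.

(** Every minor of order [s - 1] vanishes. *)
Lemma adj_eq0_rank (K : fieldType) (s : nat) (M : 'M[K]_s) :
  (\rank M < s.-1)%N -> \adj M = 0.
Proof.
move=> rkM; apply/matrixP => i j; rewrite !mxE /cofactor.
suff -> : \det (row' j (col' i M)) = 0 by rewrite mulr0.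
apply: contraTeq rkM; rewrite -unitfE -unitmxE -row_free_unit -leqNgt => /eqP {1}<-.
rewrite row'Esub (leq_trans (mxrankS (rowsub_sub _ _))) //.
by rewrite -mxrank_tr -[leqRHS]mxrank_tr tr_col' row'Esub mxrankS ?rowsub_sub.
Qed.

Section SimpleEigenvalues.
Variables (C : numClosedFieldType) (s : nat).
Implicit Types (P Q : 'M[{poly C}]_s) (w : 'rV[C]_s).

(** The adjugate cannot vanish at a simple root of the determinant, so there
    the matrix has corank one and its left kernel is the line spanned by [w];
    the rows of the adjugate lie in that kernel. *)
Lemma adj_at_simple_root P a w : mup a (\det P) = 1%N -> w != 0 ->
  w *m map_mx (horner_eval a) P = 0 ->
  exists u, map_mx (horner_eval a) (\adj P) = u *m w.
Proof.
set ev := map_mx (horner_eval a); move=> simple_a w0 wP.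
have det0 : \det P != 0 by apply: contra_eq_neq simple_a => ->; rewrite mup_poly0.
have root_a : root (\det P) a by rewrite -dvdp_XsubCl XsubC_dvd // simple_a.
have [lt_rk|ge_rk] := ltnP (\rank (ev P)) s.-1.
  have [G adjE] : exists G, \adj P = ('X - a%:P) *: G.
    by apply: mx_factor_root; rewrite map_mx_adj adj_eq0_rank.
  have /factor_theorem[d dE] := root_a.
  have PG : P *m G = d%:M.
    apply: (scalemx_inj (negbT (polyXsubC_eq0 a))).
    by rewrite scalemxAr -adjE mul_mx_adj dE scale_scalar_mx mulrC.
  have : ev (P *m G) = d.[a]%:M by rewrite PG /ev map_scalar_mx.
  rewrite [ev _]map_mxM -/(ev P) => /(congr1 (mulmx w)).
  rewrite mulmxA wP mul0mx mul_mx_scalar.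
  move/esym/eqP; rewrite scaler_eq0 (negPf w0) orbF -/(root d a).
  rewrite -dvdp_XsubCl => /dvdpP[e eE].
  have := mup_geq a 2 det0; rewrite simple_a dE eE -mulrA -expr2 /=.
  by rewrite dvdp_mulIr.
have adj_ker : (ev (\adj P) <= kermx (ev P))%MS.
  apply/sub_kermxP; rewrite /ev -map_mxM mul_adj_mx map_scalar_mx /=.
  by rewrite /horner_eval (rootP root_a) raddf0.
have w_ker : (w <= kermx (ev P))%MS by apply/sub_kermxP.
have ker_w : (kermx (ev P) <= w)%MS.
  rewrite -(geq_leqif (mxrank_leqif_sup w_ker)) mxrank_ker rank_rV w0.
  by rewrite leq_subLR addn1 (leq_trans (leqSpred s)).
exact/submxP/(submx_trans adj_ker).
Qed.

Lemma coef_monic_mul d P Q e a b : mpmonic d P -> (mpsize Q <= e.+1)%N ->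
  ((P *m Q) a b)`_(d + e) = (Q a b)`_e.
Proof.
move=> [szP monP] szQ; pose T := P - 'X^d%:M.
have szT x y : (size (T x y) <= d)%N.
  apply/leq_sizeP => i; rewrite !mxE leq_eqVlt coefB coefMn coefXn.
  case: eqP => [<- _|_ /= lt_i].
    by have /matrixP/(_ x y) := monP; rewrite !mxE /coefp eqxx => ->; rewrite subrr.
  rewrite nth_default ?(leq_trans (size_mpsize P x y)) ?szP //.
  by rewrite gtn_eqF // mul0rn subrr.
rewrite -[P](subrK 'X^d%:M) -/T mulmxDl mul_scalar_mx !mxE coefD.
rewrite coefXnM ltnNge leq_addr addKn nth_default ?add0r //.
apply: leq_trans (size_sum _ _ _) _; apply/bigmax_leqP => c _.
apply: leq_trans (size_polyMleq _ _) _.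
by rewrite -subn1 leq_subLR add1n -addnS leq_add // (leq_trans (size_mpsize Q c b)).
Qed.

(** Multiplying by a monic matrix polynomial of degree [d] raises the degree of
    a nonzero factor by [d]. *)
Lemma monic_mul_size_eq0 d P Q :
  mpmonic d P -> (mpsize (P *m Q) <= d)%N -> Q = 0.
Proof.
move=> monP szPQ.
have step e : (mpsize Q <= e.+1)%N -> (mpsize Q <= e)%N.
  move=> szQ; apply: mpsize_leq => a b; apply/leq_sizeP => i.
  rewrite leq_eqVlt => /predU1P[<-|lt_i]; last first.
    by rewrite nth_default // (leq_trans (size_mpsize Q a b)) // (leq_trans szQ).
  rewrite -(coef_monic_mul a b monP szQ) nth_default //.
  by rewrite (leq_trans (size_mpsize _ a b)) // (leq_trans szPQ) ?leq_addr.
have /(_ _ (leqnn _)) szQ e : (mpsize Q <= e)%N -> (mpsize Q <= 0)%N.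
  by elim: e => // e IHe /step/IHe.
apply/matrixP => a b; rewrite mxE; apply/eqP.
by rewrite -size_poly_leq0 (leq_trans (size_mpsize Q a b)).
Qed.

Lemma mul_deriv_lift P (n : nat) (M : 'M[C]_(s, n)) :
  map_mx (@deriv C) (P *m map_mx polyC M) = mpderiv P *m map_mx polyC M.
Proof.
apply/matrixP => a b; rewrite !mxE raddf_sum /=; apply: eq_bigr => c _.
by rewrite !mxE derivM derivC mulr0 addr0.
Qed.

(** These data describe the partial fraction expansion
    [P^-1 = \sum_i (X - theta_i)^-1 v_i w_i], the columns [G i] being
    [P v_i / (X - theta_i)]. *)
Section PartialFractions.
Variables (d r : nat) (P : 'M[{poly C}]_s) (theta : 'I_r -> C).
Variables (v : 'I_r -> 'cV[C]_s) (w : 'I_r -> 'rV[C]_s).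
Variable G : 'I_r -> 'cV[{poly C}]_s.
Hypotheses (d_gt0 : (0 < d)%N) (monP : mpmonic d P).
Hypothesis inj_theta : injective theta.
Hypothesis det_roots : forall z, root (\det P) z -> exists i, theta i = z.
Hypothesis simple_theta : forall i, mup (theta i) (\det P) = 1%N.
Hypothesis factorG :
  forall i, P *m map_mx polyC (v i) = ('X - (theta i)%:P) *: G i.
Hypothesis left_w : forall i, w i *m mphorner P (theta i) = 0.
Hypothesis norm_vw :
  forall i, w i *m mphorner (mpderiv P) (theta i) *m v i = 1%:M.

(** At [theta_l], differentiating [P v_l = (X - theta_l) G_l] leaves
    [P' v_l = G_l], whose pairing with [w_l] is normalized; for the other
    indices [w_l P(theta_l) = 0] applies. *)
Lemma eval_factorG i l :
  w l *m map_mx (horner_eval (theta l)) (G i) = (i == l)%:R%:M.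
Proof.
case: eqVneq => [->|ne_il].
  rewrite -(norm_vw l) -mulmxA; congr (_ *m _).
  have := congr1 (map_mx (horner_eval (theta l)) \o map_mx (@deriv C)) (factorG l).
  rewrite /= mul_deriv_lift map_mxM map_horner_lift -/(mphorner _ _) => ->.
  apply/matrixP => a b; rewrite !mxE /horner_eval derivM hornerD !hornerM.
  by rewrite derivXsubC !hornerE subrr mul0r addr0.
have := congr1 (fun M => w l *m map_mx (horner_eval (theta l)) M) (factorG i).
rewrite /= map_mxM map_horner_lift mulmxA -/(mphorner _ _) left_w mul0mx.
rewrite map_mxZ /= /horner_eval !hornerE -scalemxAr => /esym/eqP.
rewrite scaler_eq0 subr_eq0 (inj_eq inj_theta) eq_sym (negPf ne_il) => /eqP ->.
by rewrite raddf0.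
Qed.

Lemma size_factorG i a b : (size (G i a b) <= d)%N.
Proof.
have [->|g0] := eqVneq (G i a b) 0; first by rewrite size_poly0.
have : (size (('X - (theta i)%:P) * G i a b)%R <= d.+1)%N.
  have /matrixP/(_ a b) := factorG i; rewrite !mxE => <-.
  apply: leq_trans (size_sum _ _ _) _; apply/bigmax_leqP => c _.
  rewrite mxE mulrC mul_polyC (leq_trans (size_scale_leq _ _)) //.
  by case: monP => <- _; exact: size_mpsize.
by rewrite size_mul ?polyXsubC_eq0 // size_XsubC.
Qed.

(** Partial fractions multiplied by [P].  The difference [D] of the two sides is
    annihilated on the left by [w_l] at [theta_l], hence so is [\adj P *m D] at
    every root of [\det P]; then [P^-1 *m D] is a polynomial, and it is zero
    because [D] has degree less than [d]. *)
Lemma partial_fractions : \sum_i G i *m map_mx polyC (w i) = 1%:M.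
Proof.
apply/eqP; rewrite -subr_eq0; set D := _ - _; apply/eqP.
have w0 l : w l != 0.
  apply: contraTneq (oner_neq0 C) => wl0; have /matrixP/(_ 0 0) := norm_vw l.
  by rewrite wl0 !mul0mx !mxE eqxx mulr1n => <-; rewrite eqxx.
have wD l : w l *m map_mx (horner_eval (theta l)) D = 0.
  rewrite /D map_mxB map_mx1 raddf_sum mulmxBr mulmx1 mulmx_sumr (bigD1 l) //=.
  rewrite big1 => [|i ne_il]; rewrite map_mxM map_horner_lift mulmxA eval_factorG.
    by rewrite eqxx mul1mx addr0 subrr.
  by rewrite (negPf ne_il) raddf0 mul0mx.
have det0 : \det P != 0.
  apply/eqP => d0; have [|l _] := det_roots (z := 0); first by rewrite d0 root0.
  by have := simple_theta l; rewrite d0 mup_poly0.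
have [h hE] : exists h, \adj P *m D = \det P *: h.
  exists (map_mx (fun p => p %/ \det P) (\adj P *m D)).
  apply/matrixP => a b; rewrite [RHS]mxE [X in _ * X]mxE mulrC divpK //.
  apply: hermite_unique => // z i lt_i.
  have [l zE] : exists l, theta l = z.
    by apply: det_roots; rewrite -dvdp_XsubCl XsubC_dvd // (leq_ltn_trans _ lt_i).
  move: lt_i; rewrite -zE simple_theta ltnS leqn0 => /eqP ->; rewrite derivn0.
  have [u uE] := adj_at_simple_root (simple_theta l) (w0 l) (left_w l).
  suff /matrixP/(_ a b) : map_mx (horner_eval (theta l)) (\adj P *m D) = 0.
    by rewrite !mxE.
  by rewrite map_mxM uE -mulmxA wD mulmx0.
have DE : D = P *m h.
  apply: (scalemx_inj det0).
  by rewrite -mul_scalar_mx -mul_mx_adj -mulmxA hE scalemxAr.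
rewrite DE (monic_mul_size_eq0 (Q := h) monP) ?mulmx0 // -DE.
apply: mpsize_leq => a b; rewrite !mxE summxE.
apply: leq_trans (size_polyD _ _) _; rewrite geq_max size_polyN; apply/andP; split.
  apply: leq_trans (size_sum _ _ _) _; apply/bigmax_leqP => i _.
  rewrite mxE big_ord1 mxE mulrC mul_polyC.
  by rewrite (leq_trans (size_scale_leq _ _)) ?size_factorG.
by rewrite -polyC_natr (leq_trans (size_polyC_leq1 _)).
Qed.

End PartialFractions.
End SimpleEigenvalues.

(** * Petrov-Galerkin projection on a rational Krylov space *)

Lemma comm_invmx (K : fieldType) (n : nat) (M N : 'M[K]_n) : M \in unitmx ->
  M *m N = N *m M -> invmx M *m N = N *m invmx M.
Proof.
by move=> Mu MN; rewrite -[LHS](mulmxK Mu) -(mulmxA _ N M) -MN mulKmx.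
Qed.

(** [V] is the basis and [L] a left inverse of it, so [V L] is the oblique
    projector and [N] the projected matrix; the starting block is [V W]. *)
Section Galerkin.
Variables (K : fieldType) (n m s k : nat).
Variables (A : 'M[K]_n) (V : 'M[K]_(n, m)) (L : 'M[K]_(m, n)).
Variables (W : 'M[K]_(m, s)) (phi : {poly K}).

Let N : 'M[K]_m := L *m A *m V.
Let T := invmx (horner_mxn A phi).
Let TN := invmx (horner_mxn N phi).

Hypothesis LV : L *m V = 1%:M.
Hypothesis size_phi : (size phi <= k.+1)%N.
Hypothesis phiA_unit : horner_mxn A phi \in unitmx.
Hypothesis phiN_unit : horner_mxn N phi \in unitmx.
Hypothesis krylov_V : forall i, (i < k.+1)%N ->
  exists Y, T *m (A ^+ i *m (V *m W)) = V *m Y.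

Let X i := T *m (A ^+ i *m (V *m W)).

(** While [X i] is in the range of [V], the coordinates of [X i.+1 = A X i] are
    [L A X i = N (L X i)].  Those of [X 0] are found by summing the [X i] against
    the coefficients of [phi], which gives back [V W]. *)
Lemma galerkin_power i : (i <= k.+1)%N -> L *m X i = TN *m (N ^+ i *m W).
Proof.
have XV j : (j < k.+1)%N -> X j = V *m (L *m X j).
  by move=> /krylov_V[Y XE]; rewrite [X j]XE [L *m (V *m Y)]mulmxA LV mul1mx.
have XS j : X j.+1 = A *m X j.
  rewrite /X exprS -mulmxE -!mulmxA; rewrite !(mulmxA T) comm_invmx ?mulmxA //.
  by rewrite -{2 3}(horner_mxnX A) horner_mxn_comm.
have LX j : (j <= k.+1)%N -> L *m X j = N ^+ j *m (L *m X 0).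
  elim: j => [_|j IHj lt_j]; first by rewrite expr0 mul1mx.
  by rewrite XS XV // exprS -mulmxE -mulmxA -IHj 1?ltnW // /N !mulmxA.
have WE : W = horner_mxn N phi *m (L *m X 0).
  transitivity (L *m (T *m (horner_mxn A phi *m (V *m W)))).
    by rewrite mulKmx // mulmxA LV mul1mx.
  rewrite !(horner_mxn_wide _ size_phi) [in RHS]mulmx_suml.
  rewrite [in LHS]mulmx_suml 2!mulmx_sumr; apply: eq_bigr => j _.
  rewrite -2!scalemxAl -!scalemxAr; congr (_ *: _).
  exact: LX (ltnW (ltn_ord j)).
have X0 : TN *m W = L *m X 0 by rewrite {1}WE mulKmx.
move=> /LX ->; rewrite -X0 !mulmxA -comm_invmx //.
by rewrite -(horner_mxnXn N) horner_mxn_comm.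
Qed.

(** The oblique coordinates are still right one degree beyond the range of [V]:
    the last multiplication by [A] may leave that range, but [L] is applied
    afterwards. *)
Lemma galerkin_project P : (mpsize P <= k.+2)%N ->
  L *m (T *m mpcirc P A (V *m W)) = TN *m mpcirc P N W.
Proof.
move=> szP; rewrite !(mpcirc_wide _ _ szP) !mulmx_sumr; apply: eq_bigr => i _.
rewrite (mulmxA T) (mulmxA L) -/(X i) (galerkin_power (ltn_ord i : (i <= k.+1)%N)).
by rewrite -!mulmxA.
Qed.

Lemma galerkin_exact P : (mpsize P <= k.+1)%N ->
  T *m mpcirc P A (V *m W) = V *m (TN *m mpcirc P N W).
Proof.
move=> szP; rewrite -galerkin_project ?(leq_trans szP) //.
rewrite !(mpcirc_wide _ _ szP) !mulmx_sumr; apply: eq_bigr => i _.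
have [Y XE] := krylov_V (ltn_ord i); rewrite (mulmxA T) XE !mulmxA.
by rewrite -(mulmxA V L V) LV mulmx1.
Qed.

(** The block Krylov space fills the range of [V], so [W] generates the whole
    projected space and a polynomial in [N] that kills [W] is zero. *)
Lemma galerkin_annihilator (q : {poly K}) : (0 < s)%N ->
    (forall Y, exists2 P, (mpsize P <= k.+1)%N &
       V *m Y = T *m mpcirc P A (V *m W)) ->
  horner_mxn N q *m W = 0 -> horner_mxn N q = 0.
Proof.
move=> s_gt0 V_krylov qW.
have qY (Y : 'M[K]_(m, s)) : horner_mxn N q *m Y = 0.
  have [P szP] := V_krylov Y; rewrite galerkin_exact // => VY.
  have -> : Y = TN *m mpcirc P N W.
    by rewrite -[Y]mul1mx -LV -mulmxA VY mulmxA LV mul1mx.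
  rewrite mulmxA -(comm_invmx phiN_unit (horner_mxn_comm N phi q)) -mulmxA.
  rewrite -mpcirc_mulmx qW.
  by rewrite mpcircr0 mulmx0.
apply/matrixP => a b.
have /matrixP/(_ a (Ordinal s_gt0)) := qY (delta_mx b (Ordinal s_gt0)).
rewrite !mxE (bigD1 b) //= big1 => [|c ne_cb].
  by rewrite !mxE !eqxx mulr1 addr0.
by rewrite !mxE (negPf ne_cb) mulr0.
Qed.

(** Since [Lambda] and ['X *: P] are both monic, [T (Lambda(A) o V W)] and
    [A XK RB = T A (P(A) o V W)] differ by [T (D(A) o V W)] with [D] of degree at
    most [k]; this lies in the range of [V], which [1 - V L] annihilates.  And
    [1 - V L] fixes [T (Lambda(A) o V W)], whose coordinates [Lambda(N) o W] up to
    [phi(N)^-1] are zero. *)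
Lemma galerkin_residual Lambda P (XK E : 'M[K]_(n, s)) Y RB :
    mpmonic k.+1 Lambda -> mpcirc Lambda N W = 0 -> mpmonic k P ->
    XK *m RB = T *m mpcirc P A (V *m W) -> A *m XK = V *m Y + E ->
  T *m mpcirc Lambda A (V *m W) = (1%:M - V *m L) *m E *m RB.
Proof.
move=> [szL monL] circL [szP monP] XRB AX.
have VL_V (l : nat) (M : 'M[K]_(m, l)) : (1%:M - V *m L) *m (V *m M) = 0.
  by rewrite mulmxBl mul1mx -!mulmxA (mulmxA L) LV mul1mx subrr.
pose D := Lambda - 'X *: P.
have szD : (mpsize D <= k.+1)%N.
  apply: mpsize_sub_monic; rewrite ?szL //.
    apply: mpsize_leq => a b; rewrite mxE mulrC (leq_trans (size_polyMleq _ _)) //.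
    by rewrite size_polyX addn2 ltnS -szP size_mpsize.
  by rewrite monL -monP; apply/matrixP => a b; rewrite !mxE /coefp coefXM.
have AXRB : T *m mpcirc ('X *: P) A (V *m W) = A *m XK *m RB.
  rewrite -mulmxA XRB -mul_mx_scalar mpcircM mpcirc_scalar horner_mxnX.
  by rewrite mulmxA comm_invmx ?mulmxA // -{2 3}(horner_mxnX A) horner_mxn_comm.
have LE : Lambda = D + 'X *: P by rewrite subrK.
have TE : T *m mpcirc Lambda A (V *m W) =
    (1%:M - V *m L) *m (T *m mpcirc Lambda A (V *m W)).
  by rewrite mulmxBl mul1mx -mulmxA galerkin_project ?szL // circL !mulmx0 subr0.
rewrite TE {1}LE mpcircD mulmxDr (galerkin_exact szD) AXRB AX mulmxDr.
by rewrite VL_V add0r mulmxA [_ *m (_ + E)]mulmxDr VL_V add0r.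
Qed.

End Galerkin.

Section ProjectionError.
Variables (C : numClosedFieldType) (n m s k r : nat).
Variables (A : 'M[C]_n) (V : 'M[C]_(n, m)) (L : 'M[C]_(m, n)) (W : 'M[C]_(m, s)).
Variables (phi : {poly C}) (P : 'M[{poly C}]_s) (theta : 'I_r -> C).
Variables (v : 'I_r -> 'cV[C]_s) (w : 'I_r -> 'rV[C]_s).
Variable G : 'I_r -> 'cV[{poly C}]_s.

Let N : 'M[C]_m := L *m A *m V.
Let T := invmx (horner_mxn A phi).

Hypotheses (phiA_unit : horner_mxn A phi \in unitmx)
  (phiN_unit : horner_mxn N phi \in unitmx).
Hypothesis exact_V : forall Q, (mpsize Q <= k.+1)%N ->
  T *m mpcirc Q A (V *m W) = V *m (invmx (horner_mxn N phi) *m mpcirc Q N W).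
Hypothesis P_charpoly : mpcirc P N W = 0.
Hypothesis factorG :
  forall i, P *m map_mx polyC (v i) = ('X - (theta i)%:P) *: G i.
Hypothesis sizeG : forall i a b, (size (G i a b) <= k.+1)%N.
Hypothesis fractions : \sum_i G i *m map_mx polyC (w i) = 1%:M.

(** Right division of [q I = phi p I] by [P]: by partial fractions the quotient
    is [Q = \sum_i dd_i v_i w_i], and the remainder [S] has degree at most [k].
    The projection is exact on [S] while [P] kills [W], so the whole
    error comes from [Q]. *)
Lemma projection_error (p : {poly C}) (dd : 'I_r -> {poly C}) :
  (forall i, phi * p - ((phi * p).[theta i])%:P = dd i * ('X - (theta i)%:P)) ->
  horner_mxn A p *m (V *m W) - V *m (horner_mxn N p *m W) =
    \sum_i horner_mxn A (dd i) *m (T *m mpcirc P A (V *m W)) *m v i *m w i.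
Proof.
move=> ddE; set q := phi * p in ddE.
pose Q : 'M[{poly C}]_s := \sum_i dd i *: map_mx polyC (v i *m w i).
pose S : 'M[{poly C}]_s := \sum_i q.[theta i]%:P *: (G i *m map_mx polyC (w i)).
have qE : q%:M = P *m Q + S.
  rewrite mulmx_sumr -big_split -scalemx1 -fractions scaler_sumr.
  apply: eq_bigr => i _ /=; rewrite -scalemxAr map_mxM mulmxA factorG -scalemxAl.
  by rewrite scalerA -ddE scalerBl subrK.
have szS : (mpsize S <= k.+1)%N.
  apply: mpsize_leq => a b; rewrite summxE.
  apply: leq_trans (size_sum _ _ _) _; apply/bigmax_leqP => i _.
  rewrite !mxE big_ord1 mxE mul_polyC (leq_trans (size_scale_leq _ _)) //.
  by rewrite mulrC mul_polyC (leq_trans (size_scale_leq _ _)).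
have circ_q l (M : 'M[C]_l) X :
    horner_mxn M q *m X = mpcirc Q M (mpcirc P M X) + mpcirc S M X.
  by rewrite -mpcirc_scalar qE mpcircD mpcircM.
have pE l (M : 'M[C]_l) X : horner_mxn M phi \in unitmx ->
    horner_mxn M p *m X = invmx (horner_mxn M phi) *m (horner_mxn M q *m X).
  by move=> Mu; rewrite horner_mxnM -mulmxA mulKmx.
rewrite !pE // !circ_q P_charpoly mpcircr0 add0r mulmxDr -/T (exact_V szS) addrK.
rewrite mpcirc_sum mulmx_sumr; apply: eq_bigr => i _.
rewrite mpcirc_scale !mulmxA; congr (_ *m _ *m _ *m _).
by rewrite (comm_invmx phiA_unit (horner_mxn_comm A phi (dd i))).
Qed.

End ProjectionError.

(** * The block rational Arnoldi decomposition *)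

Section BlockBasis.
Variables (C : numClosedFieldType) (n s k : nat).
Implicit Types U : 'I_k.+2 -> 'M[C]_(n, s).

Lemma basis_init_mul U (D : 'I_k.+1 -> 'M[C]_s) :
  basis_init U *m \mxcol_i D i = \sum_i U (widen_ord (leqnSn k.+1) i) *m D i.
Proof. exact: mul_mxrow_mxcol. Qed.

Lemma basis_all_mul U (D : 'I_k.+2 -> 'M[C]_s) :
  basis_all U *m \mxcol_i D i =
    basis_init U *m \mxcol_i D (widen_ord (leqnSn k.+1) i) + U ord_max *m D ord_max.
Proof. by rewrite basis_init_mul mul_mxrow_mxcol big_ord_recr. Qed.

Lemma basis_init_e1 U : basis_init U *m block_e1 C s k = U ord0.
Proof.
rewrite basis_init_mul (bigD1 ord0) //= big1 => [|i /negPf ->]; last first.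
  by rewrite raddf0 mulmx0.
by rewrite addr0 mulmx1; congr (U _); apply: val_inj.
Qed.

Lemma block_span_init U (X : 'M[C]_(n, s)) :
  block_span U k.+1 X <-> exists Y, X = basis_init U *m Y.
Proof.
have spanE (D : 'I_k.+2 -> 'M[C]_s) : \sum_(i < k.+2 | (i < k.+1)%N) U i *m D i =
    basis_init U *m \mxcol_i D (widen_ord (leqnSn k.+1) i).
  rewrite basis_init_mul big_mkcond big_ord_recr /= ltnn addr0.
  by apply: eq_bigr => i _; rewrite ltn_ord.
split=> [[D _ <-]|[Y ->]]; first by rewrite spanE; eexists.
(* The block of index [k.+1] lies outside the sum; its value 0 is arbitrary. *)
exists (fun i => if insub (i : nat) is Some j then submxcol Y j else 0) => //.
rewrite spanE -[in RHS](submxcolK Y); congr (_ *m _).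
apply: eq_mxcol => i; rewrite /= insubT //= => lt_i.
by congr (submxcol Y _); apply: val_inj.
Qed.

Lemma size_shift_poly (sigma : 'I_k -> option C) :
  (size (shift_poly sigma) <= k.+1)%N.
Proof.
apply: leq_trans (size_prod_leq _ _) _.
rewrite leq_subLR cardT size_enum_ord addnS ltnS.
have -> : (k + k = \sum_(i < k) 2)%N.
  by rewrite sum_nat_const card_ord mulnC mul2n addnn.
by apply: leq_sum => i _; case: (sigma i) => [x|]; rewrite ?size_XsubC ?size_poly1.
Qed.

Lemma shift_poly_unitmx (sigma : 'I_k -> option C) (m : nat) (M : 'M[C]_m) :
  (forall i x, sigma i = Some x -> ~~ eigenvalue M x) ->
  horner_mxn M (shift_poly sigma) \in unitmx.
Proof.
move=> sigmaN; apply: horner_mxn_unit => i.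
case sE: (sigma i) => [x|]; last by rewrite horner_mxn1 unitmx1.
by rewrite horner_mxn_XsubC eigenvalueN_unitmx // (sigmaN i).
Qed.

End BlockBasis.

Theorem corollary3p1 (R : realType) (n s k : nat)
    (A : 'M[R[i]]_n) (B : 'M[R[i]]_(n, s)) (sigma : 'I_k -> option R[i])
    (U : 'I_k.+2 -> 'M[R[i]]_(n, s)) (RB : 'M[R[i]]_s)
    (H Kx : 'M[R[i]]_(\sum_(i < k.+2) s, \sum_(i < k.+1) s))
    (Z : 'M[R[i]]_(n, \sum_(i < k.+1) s))
    (f : R[i] -> R[i])
    (Lambda : 'M[{poly R[i]}]_s)
    (theta : 'I_(k.+1 * s) -> R[i])
    (v w : 'I_(k.+1 * s) -> 'cV[R[i]]_s)
    (hs : (1 < s)%N)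
    (hsigmaA : forall i x, sigma i = Some x -> ~~ eigenvalue A x)
    (harnoldi : block_rational_arnoldi A B sigma U RB H Kx)
    (hZ : Z^t* *m Z = 1%:M)
    (hZU : Z^t* *m basis_init U \in unitmx)
    (hsigmaAj : forall i x, sigma i = Some x ->
       ~~ eigenvalue (pg_matrix A U Z) x)
    (hf : forall a, eigenvalue A a -> analytic_at f a)
    (hfAj : mxfun_defined f (pg_matrix A U Z))
    (hLambda : monic_block_charpoly k.+1 (pg_matrix A U Z)
       (block_e1 _ s k *m RB) Lambda)
    (htheta : injective theta)
    (htheta_eig : forall z, root (\det Lambda) z <-> exists i, theta i = z)
    (htheta_simple : forall i, mup (theta i) (\det Lambda) = 1%N)
    (htheta_A : forall i, ~~ eigenvalue A (theta i))
    (hv : forall i, mphorner Lambda (theta i) *m v i = 0)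
    (hw : forall i, (w i)^t* *m mphorner Lambda (theta i) = 0)
    (hwv : forall i,
       (w i)^t* *m mphorner (mpderiv Lambda) (theta i) *m v i = 1%:M) :
  let phi := shift_poly sigma in
  let phiA := horner_mxn A phi in
  let divdiff i :=
    (phiA *m mxfun f A - (phi.[theta i] * f (theta i))%:M)
      *m invmx (A - (theta i)%:M) in
  mxfun f A *m B - pg_approx f A U RB Z =
    \sum_(i < k.+1 * s)
      divdiff i *m (invmx phiA *m mpcirc Lambda A B) *m v i *m (w i)^t*
  /\
  (pencil_normalized A B sigma U RB Kx ->
   mxfun f A *m B - pg_approx f A U RB Z =
    \sum_(i < k.+1 * s)
      divdiff i *m pg_coprojector U Z *m U ord_max *m last_subdiag H *m RB
        *m v i *m (w i)^t*).
Proof.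
move=> phi phiA divdiff.
have s_gt0 : (0 < s)%N by exact: ltnW.
case: harnoldi => _ span_j _ BE _ _ rel _ _ _.
pose V := basis_init U; pose L := invmx (Z^t* *m V) *m Z^t*.
pose W := block_e1 _ s k *m RB; pose N := L *m A *m V.
have LV : L *m V = 1%:M by rewrite /L -mulmxA mulVmx.
have NE : pg_matrix A U Z = N by [].
have VW : V *m W = B by rewrite /V /W mulmxA basis_init_e1 BE.
have phiA_unit : phiA \in unitmx by apply: shift_poly_unitmx.
have phiN_unit : horner_mxn N phi \in unitmx by apply: shift_poly_unitmx.
have size_phi : (size phi <= k.+1)%N by exact: size_shift_poly.
have [monL circL] := hLambda; rewrite NE -/W in circL.
have krylovV i : (i < k.+1)%N ->
    exists Y, invmx phiA *m (A ^+ i *m (V *m W)) = V *m Y.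
  move=> lt_i; apply/block_span_init; rewrite -span_j.
  exists ('X^i)%:M; last by rewrite mpcirc_scalar horner_mxnXn VW.
  apply: mpsize_leq => a b; rewrite mxE.
  by case: eqP => _; rewrite ?mulr1n ?mulr0n ?size_polyXn ?size_poly0.
have krylov_full Y : exists2 P, (mpsize P <= k.+1)%N &
    V *m Y = invmx phiA *m mpcirc P A (V *m W).
  have : block_krylov A B sigma k.+1 (V *m Y).
    by rewrite span_j; apply/block_span_init; exists Y.
  by rewrite VW => -[P szP <-]; exists P.
have detN : horner_mxn N (\det Lambda) = 0.
  apply: (galerkin_annihilator LV size_phi phiA_unit phiN_unit krylovV) => //.
  exact: mpcirc_eq0_det.
have det0 : \det Lambda != 0.
  apply/eqP => d0; have [|l _] := (htheta_eig 0).1; first by rewrite d0 root0.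
  by have := htheta_simple l; rewrite d0 mup_poly0.
(* One polynomial stands for [f] on both spectra: it interpolates [f] at the
   roots of the minimal polynomial of [A] and at those of [\det Lambda]. *)
pose m := minpoly_mxn A * \det Lambda.
have m0 : m != 0 by rewrite mulf_neq0 ?minpoly_mxn_neq0.
have [p pE] := hermite_exists (fun a i => cderive i f a) m0.
have fA : mxfun f A = horner_mxn A p.
  apply: mxfun_interpolant => a i lt_i; apply: pE; apply: leq_trans lt_i _.
  by rewrite mup_dvdp_leq // dvdp_mulIl.
have fN : mxfun f N = horner_mxn N p.
  apply: mxfun_interpolant => a i lt_i; apply: pE; apply: leq_trans lt_i _.
  rewrite mup_dvdp_leq // (dvdp_trans (y := \det Lambda)) ?dvdp_mulIr //.
  by rewrite minpoly_mxn_dvd detN.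
have ftheta i : p.[theta i] = f (theta i).
  have le_mup := mup_dvdp_leq (theta i) m0 (dvdp_mulIr _ _).
  rewrite -[p]derivn0 pE // (leq_trans _ le_mup) //.
  by rewrite htheta_simple.
have factorG i : exists G : 'cV_s,
    Lambda *m map_mx polyC (v i) = ('X - (theta i)%:P) *: G.
  by apply: mx_factor_root; rewrite map_mxM map_horner_lift; apply: hv.
pose G i := projT1 (cid (factorG i)).
have GE i : Lambda *m map_mx polyC (v i) = ('X - (theta i)%:P) *: G i.
  exact: projT2 (cid (factorG i)).
have fractions : \sum_i G i *m map_mx polyC ((w i)^t*) = 1%:M.
  apply: (partial_fractions (ltn0Sn k) monL htheta _ htheta_simple GE) => //.
  by move=> z /htheta_eig.
have sizeG := size_factorG monL GE.
pose dd i := (phi * p - ((phi * p).[theta i])%:P) %/ ('X - (theta i)%:P).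
have ddE i : phi * p - ((phi * p).[theta i])%:P = dd i * ('X - (theta i)%:P).
  by rewrite /dd divpK // dvdp_XsubCl rootE !hornerE subrr.
have divdiffE i : divdiff i = horner_mxn A (dd i).
  rewrite /divdiff fA -horner_mxnM -ftheta -hornerM -(horner_mxnC A).
  rewrite -[X in _ - X]scale1r -scaleNr -horner_mxnZ scaleN1r -horner_mxnD ddE.
  by rewrite horner_mxnM horner_mxn_XsubC mulmxK // eigenvalueN_unitmx.
have exactV Q (szQ : (mpsize Q <= k.+1)%N) :=
  galerkin_exact LV size_phi phiA_unit phiN_unit krylovV szQ.
have error : mxfun f A *m B - pg_approx f A U RB Z =
    \sum_i divdiff i *m (invmx phiA *m mpcirc Lambda A B) *m v i *m (w i)^t*.
  rewrite /pg_approx NE fN fA -[in LHS](mulmxA _ (block_e1 _ _ _)) -/W -/V.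
  under [RHS]eq_bigr do rewrite divdiffE.
  rewrite -VW -[_ *m _ *m W]mulmxA.
  exact: (projection_error phiA_unit phiN_unit exactV circL GE sizeG fractions).
split=> // -[P monP XRB].
suff residual : invmx phiA *m mpcirc Lambda A B =
    pg_coprojector U Z *m U ord_max *m last_subdiag H *m RB.
  by rewrite error; apply: eq_bigr => i _; rewrite residual !mulmxA.
pose X := basis_all U *m submxrow Kx ord_max.
have [Y AXE] : exists Y, A *m X = V *m Y + U ord_max *m last_subdiag H.
  rewrite /X mulmxA mul_submxrow rel -mul_submxrow.
  rewrite -[submxrow H _]submxcolK basis_all_mul; eexists; congr (_ + _ *m _).
  by rewrite -submxblockEh.
have szLambda : (mpsize Lambda <= k.+2)%N by case: monL => ->.
rewrite -VW; rewrite -VW in XRB.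
rewrite (galerkin_residual LV size_phi phiA_unit phiN_unit krylovV monL circL
  monP XRB AXE).
by rewrite /pg_coprojector /L !mulmxA.
Qed.
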